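(* Let $q>2$ be a prime power, let $\mathbb{F}_q[x]$ be the ring of polynomials over the finite field $\mathbb{F}_q$, and let $R$ be a quotient ring of $\mathbb{F}_q[x]$ with $R\neq 0$ and $R\neq \mathbb{F}_q[x]$. Let $\mathcal{S}_R$ denote the multiplicative semigroup of $R$ and $U(\mathcal{S}_R)$ its group of units. Then $\mathrm{D}(\mathcal{S}_R)=\mathrm{D}(U(\mathcal{S}_R))$.
   Context: For a commutative semigroup $\mathcal{S}$ (written additively, operation $+$; here the operation is ring multiplication), a sequence $T=a_1\cdot a_2\cdot\ldots\cdot a_\ell$ of elements of $\mathcal{S}$ (a finite unordered multiset, repetitions allowed) has sum $\sigma(T)=a_1+\cdots+a_\ell$. If $\mathcal{S}$ has an identity $0_{\mathcal{S}}$, the empty sequence is allowed as a subsequence with sum $0_{\mathcal{S}}$. $T$ is called reducible if it has a proper subsequence $T'\neq T$ (possibly empty, when $\mathcal{S}$ has an identity) with $\sigma(T')=\sigma(T)$. The Davenport constant $\mathrm{D}(\mathcal{S})$ is the smallest $\ell\in\mathbb{N}\cup\{\infty\}$ such that every sequence of elements of $\mathcal{S}$ of length at least $\ell$ is reducible. For a finite abelian group $G$ this coincides with the classical Davenport constant: the least $\ell$ such that every sequence of length at least $\ell$ in $G$ has a nonempty subsequence summing to the identity. The group of units $U(\mathcal{S})$ is the set of elements $a$ with $a+a'=0_{\mathcal{S}}$ for some $a'\in\mathcal{S}$. *)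

(* Defs.v *)
From HB Require Import structures.
From mathcomp Require Import all_boot all_order all_algebra.
From mathcomp Require Import finmap multiset.
From mathcomp Require Import boolp.

Set Implicit Arguments.
Unset Strict Implicit.
Unset Printing Implicit Defensive.

Import GRing.Theory.
Local Open Scope ring_scope.
Local Open Scope mset_scope.

(* Commutative semigroups with identity are rendered by nmodType: additive
   notation, identity 0. Sequences over S are unordered, hence elements of
   {mset S}; their length is the size of the enumeration with multiplicity. *)

Section Davenport.

Variable S : nmodType.

Definition sigma (T : {mset S}) : S := \sum_(a <- T) a.

(* T' is allowed to be mset0, because S has an identity. *)
Definition reducible (T : {mset S}) : Prop :=
  exists2 T' : {mset S}, T' `<` T & sigma T' = sigma T.

Definition davenport_bound (l : nat) : bool :=
  `[< forall T : {mset S}, (l <= size T)%N -> reducible T >].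

(* An element of N U {oo}, with None standing for oo. *)
Definition davenport : option nat :=
  if pselect (exists l, davenport_bound l) is left h then Some (ex_minn h)
  else None.

End Davenport.

Section Units.

Variable S : nmodType.

Definition is_unit : {pred S} := fun a => `[< exists a', a + a' = 0 >].

Fact is_unit_nmod_closed : GRing.nmod_closed is_unit.
Proof.
split; first by apply/asboolP; exists 0; rewrite addr0.
move=> a b /asboolP[a' aa'] /asboolP[b' bb']; apply/asboolP.
by exists (a' + b'); rewrite addrACA aa' bb' addr0.
Qed.

(* U(S), with the addition and the identity of S. *)
Record unit_group : Type := UnitGroup {
  unit_val :> S;
  unit_valP : unit_val \in is_unit
}.

HB.instance Definition _ := [isSub for unit_val].
HB.instance Definition _ := [Choice of unit_group by <:].
HB.instance Definition _ :=
  GRing.SubChoice_isSubNmodule.Build S is_unit unit_group is_unit_nmod_closed.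

End Units.

(* S_R: the carrier of R, on which the additive notation of nmodType denotes
   the multiplication of R; in particular 0 : mul_semigroup R is 1 : R. *)
Definition mul_semigroup (R : comNzRingType) : Type := R.

HB.instance Definition _ (R : comNzRingType) := Choice.on (mul_semigroup R).
HB.instance Definition _ (R : comNzRingType) :=
  GRing.isNmodule.Build (mul_semigroup R)
    (@mulrA R) (@mulrC R) (@mul1r R).

(* Main.v *)
(* A unit sequence has the same reducibility in S_R as in U(S_R), so it suffices
   to turn an irreducible sequence T over R into an irreducible sequence of units
   of the same length.  Let s be the product of the terms processed so far,
   starting from 1.  If some remaining term v enlarges the annihilator of s, then
   some unit u fixes s v but not s, because F has a scalar other than 0 and 1:
   replace v by u and pass to s v.  Once no term does so, each remaining term acts
   on s like some unit, which replaces it.  A nonempty subproduct of these units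
   equal to 1 either gives a subproduct of the last terms fixing s, contradicting
   irreducibility of T, or consists of some of the u's only, and then the u chosen
   last among them would fix its own s. *)
Require Import Defs.
From mathcomp Require Import all_boot all_order all_algebra.
From mathcomp Require Import finmap multiset.
From mathcomp Require Import boolp ring.
Set Implicit Arguments.
Unset Strict Implicit.
Unset Printing Implicit Defensive.

Import GRing.Theory.
Local Open Scope mset_scope.
Local Open Scope ring_scope.

(** * Reducibility in terms of lists *)

Section Reducible.
Variable S : nmodType.

Lemma reducible_perm (T : {mset S}) :
  reducible T <-> exists A B : seq S,
    [/\ perm_eq T (A ++ B), B != [::] & \sum_(a <- A) a = \sum_(a <- T) a].
Proof.
split=> [[T' ltT' eqT]|[A [B [TAB B0 eqA]]]].
- exists T', (msetB T T'); split=> //.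
    apply/allP=> x _ /=; rewrite count_cat !count_mem_mset.
    by rewrite msetE2 subnKC //; apply/msubsetP/mproper_sub.
  apply: contraTneq ltT' => B0; rewrite mproperE negb_and negbK -(msetB_eq0 T).
  rewrite orbC -[msetB T T']seq_mset_id B0 -[mset0]seq_mset_id enum_mset0.
  by rewrite eqxx.
- have eqs : perm_eq (seq_mset A) A := perm_eq_seq_mset A.
  exists (seq_mset A); last by rewrite /sigma (perm_big A).
  rewrite mproperE; apply/andP; split.
    apply/msubsetP=> x; rewrite mset_seqE -count_mem_mset.
    by rewrite (permP TAB) count_cat leq_addr.
  apply/negP=> /msubsetP leTA; case: B B0 TAB => // b B _ TAB.
  have := leTA b; rewrite mset_seqE -count_mem_mset (permP TAB) count_cat /= eqxx.
  by rewrite leqNgt addnA addn1 addSn ltnS leq_addr.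
Qed.

End Reducible.

Lemma eq_davenport (S S' : nmodType) :
  @davenport_bound S =1 @davenport_bound S' -> davenport S = davenport S'.
Proof.
move=> eqb; rewrite /davenport.
case: pselect => h; case: pselect => h' //.
- by congr Some; apply: eq_ex_minn.
- by case: h'; case: h => l; rewrite eqb; exists l.
- by case: h; case: h' => l; rewrite -eqb; exists l.
Qed.

(** Convertible to the condition in [is_unit] for [mul_semigroup R]. *)
Definition invertible (R : comNzRingType) (u : R) : Prop := exists w, u * w = 1.

Lemma invertible_1Dnil (R : comNzRingType) (x : R) n :
  x ^+ n = 0 -> invertible (1 + x).
Proof.
move=> xn0; exists (\sum_(i < n) (- x) ^+ i); apply: oppr_inj.
by rewrite -mulNr opprD [- 1 - x]addrC -subrX1 exprNn xn0 mulr0 sub0r.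
Qed.

(** * Replacing ring elements by units *)

Section UnitsOfSequence.

Variable R : comNzRingType.
Hypothesis idem_power :
  forall x : R, exists2 n, (0 < n)%N & x ^+ n * x ^+ n = x ^+ n.
Variable c : R.
Hypotheses (c_inv : invertible c) (c1_inv : invertible (c - 1)).

(** An idempotent power [e] of [v] splits the ring into a component where [v] is invertible and one
    where it is nilpotent; the case depends on whether [s] lies in the first. *)
Lemma lift_unit_or_split (s v : R) :
  (exists2 w, invertible w & w * s = v * s) \/
  (exists2 u, invertible u & u * s != s /\ u * (s * v) = s * v).
Proof.
have [[//|n] _ ee] := idem_power v; set e := v ^+ n.+1 in ee.
have ve : v * v ^+ n = e by rewrite -exprS.
have ef : e * (1 - e) = 0 by rewrite mulrBr mulr1 ee subrr.
have [es|nes] := eqVneq ((1 - e) * s) 0.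
  have {}es : s = e * s by apply/eqP; rewrite -subr_eq0 -{1}[s]mul1r -mulrBl es.
  (* This unit is [v] on the component of [e] and 1 on the other. *)
  left; exists (e * v + (1 - e)); last by rewrite {1}es es; ring: ee.
  by exists (e * v ^+ n + (1 - e)); ring: ee ve.
right.
(* The last nonzero element of the sequence (1 - e) v^j s yields u: for j = 0 the
   unit u scales by c on the component 1 - e, and for j > 0 it is 1 plus the
   nilpotent (1 - e) v^j. *)
pose P j := (1 - e) * v ^+ j * s == 0.
have exP : exists j, P j.
  by exists n.+1; rewrite /P -/e [(1 - e) * e]mulrC ef mul0r.
case: (ex_minnP exP) => -[|[|j]] Pj minj.
- by case/negP: nes; move: Pj; rewrite /P expr0 mulr1.
- have {}Pj : (1 - e) * (s * v) = 0 by rewrite -[RHS](eqP Pj) expr1; ring.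
  have [d cd] := c_inv; have [d1 cd1] := c1_inv.
  exists (e + c * (1 - e)); first by exists (e + d * (1 - e)); ring: ee cd.
  (* As [c - 1] is invertible, [t] is fixed only if [(1 - e) * t] vanishes. *)
  have uE t : (e + c * (1 - e)) * t = t + (c - 1) * ((1 - e) * t) by ring.
  split; last by rewrite uE Pj mulr0 addr0.
  apply: contra nes; rewrite uE -subr_eq0 addrAC subrr add0r => /eqP us.
  by rewrite -[_ * s]mul1r -{1}cd1 mulrAC us mul0r.
- pose x := (1 - e) * v ^+ j.+1.
  have {}Pj : x * (s * v) = 0.
    by rewrite -[RHS](eqP Pj) /x [v ^+ j.+2]exprSr; ring.
  have xs : x * s != 0.
    by apply/negP => xs; have := minj _ xs; rewrite ltnn.
  exists (1 + x).
    apply: (@invertible_1Dnil _ _ n.+1).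
    (* The power contains the factor [(1 - e) * e], since [v ^+ n.+1] is [e]. *)
    rewrite /x exprMn exprAC -/e [e ^+ _]exprS [_ ^+ n.+1]exprS mulrACA.
    by rewrite [(1 - e) * e]mulrC ef mul0r.
  split; last by rewrite mulrDl mul1r Pj addr0.
  by rewrite mulrDl mul1r -subr_eq0 addrAC subrr add0r.
Qed.

(** Carrying the factor [s] makes the hypothesis stable under moving a term of [l] into [s], which
    drives the induction on length. *)
Lemma units_of_seq (l : seq R) (s : R) :
  (forall A B, perm_eq l (A ++ B) -> B != [::] ->
     s * \prod_(a <- A) a != s * \prod_(a <- l) a) ->
  exists us : seq R,
    [/\ size us = size l, forall u, u \in us -> invertible u &
        forall B, subseq B us -> B != [::] -> (\prod_(a <- B) a) * s != s].
Proof.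
move: {2}(size l) (erefl (size l)) => n; elim: n => [|n IHn] in l s *.
  by move=> /size0nil -> _; exists [::]; split=> // B; rewrite subseq0 => ->.
move=> size_l irr.
have [[v [vl [u u_inv [us usv]]]]|split_l] :=
  pselect (exists v, v \in l /\
    exists2 u, invertible u & u * s != s /\ u * (s * v) = s * v).
- have lv : perm_eq l (v :: rem v l) by exact: perm_to_rem.
  have [|A B lAB B0|us' [size_us' inv_us' irr_us']] := IHn (rem v l) (s * v).
  + by rewrite size_rem // size_l.
  + have := irr (v :: A) B; rewrite (perm_big _ lv) !big_cons !mulrA; apply=> //.
    by rewrite (perm_trans lv) //= perm_cons.
  exists (u :: us'); split=> [|w|B].
  + by rewrite /= size_us' size_rem // size_l.
  + by rewrite inE => /predU1P[->//|/inv_us'].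
  + case: B => // b B; rewrite /=; case: eqP => [->|_] sB _; last first.
      by apply: contra (irr_us' _ sB isT) => /eqP E; rewrite mulrA E.
    have [B0|B0] := eqVneq B [::]; first by rewrite B0 big_seq1.
    (* Multiplied by [v], the relation loses [u], which fixes [s * v]. *)
    apply: contra (irr_us' _ sB B0) => /eqP E.
    rewrite -{1}usv -{2}E big_cons; apply/eqP; ring.
- have /choice[f fP] : forall v, exists w,
      v \in l -> invertible w /\ w * s = v * s.
    move=> v; have [vl|] := boolP (v \in l); last by exists 0.
    have [[w]|split_v] := lift_unit_or_split s v; first by exists w.
    by case: split_l; exists v.
  have prod_f (B : seq R) : {subset B <= l} ->
      (\prod_(a <- map f B) a) * s = (\prod_(a <- B) a) * s.
    elim: B => [|b B IHB] sBl; first by rewrite !big_nil.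
    rewrite /= !big_cons -!mulrA IHB => [|x xB]; last first.
      by rewrite sBl // inE xB orbT.
    by rewrite mulrCA (fP b _).2 ?sBl ?mem_head // mulrCA.
  exists (map f l); split=> [|u /mapP[v vl ->]|B].
  + by rewrite size_map.
  + by have [] := fP v vl.
  + case/subseqP => m size_m ->; rewrite -map_mask => B0.
    have sB : subseq (mask m l) l by exact: mask_subseq.
    rewrite prod_f; last exact: mem_subseq.
    have [A lBA] := perm_to_subseq sB.
    have lAB : perm_eq l (A ++ mask m l).
      by rewrite (perm_trans lBA) // perm_catC.
    (* If the selected terms fix [s], dropping them from [l] leaves [s] times the product
       unchanged. *)
    apply: contra (irr A (mask m l) lAB _); last by case: (mask _ _) B0.
    rewrite (perm_big _ lBA) big_cat /= => /eqP E; apply/eqP.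
    by rewrite -{1}E [RHS]mulrCA mulrA.
Qed.

End UnitsOfSequence.

(** * Comparison of the two Davenport constants *)

Section DavenportUnits.

Variable R : comNzRingType.
Hypothesis idem_power :
  forall x : R, exists2 n, (0 < n)%N & x ^+ n * x ^+ n = x ^+ n.
Variable c : R.
Hypotheses (c_inv : invertible c) (c1_inv : invertible (c - 1)).

Let S : nmodType := mul_semigroup R.
Let U : nmodType := unit_group S.

Lemma sum_mul_semigroup (s : seq R) :
  \sum_(a <- (s : seq S)) a = \prod_(a <- s) a.
Proof. by []. Qed.

Lemma sum_val (s : seq U) : val (\sum_(u <- s) u) = \sum_(a <- map val s) a.
Proof. by rewrite raddf_sum big_map. Qed.

Lemma lift_units (s : seq S) :
  (forall u, u \in s -> invertible u) -> exists s' : seq U, map val s' = s.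
Proof.
elim: s => [|a s IHs] inv_s; first by exists [::].
have [|s' <-] := IHs; first by move=> u us; apply: inv_s; rewrite inE us orbT.
have a_unit : a \in @is_unit S by apply/asboolP/inv_s; rewrite mem_head.
by exists (UnitGroup a_unit :: s').
Qed.

(** Subsequences of a sequence of units consist of units, so they lift to [U]. *)
Lemma reducible_units (T : seq U) :
  reducible (seq_mset (map val T : seq S)) -> reducible (seq_mset T).
Proof.
case/reducible_perm=> A [B [TAB B0 eqA]].
have {}TAB : perm_eq (map val T) (A ++ B).
  by rewrite -(permPl (perm_eq_seq_mset (map val T))).
have [|s' s'AB] := lift_units (s := A ++ B).
  by move=> u; rewrite -(perm_mem TAB) => /mapP[x _ ->]; apply/asboolP/(valP x).
apply/reducible_perm; exists (take (size A) s'), (drop (size A) s'); split.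
- rewrite (permPl (perm_eq_seq_mset T)) cat_take_drop.
  by apply: (perm_map_inj val_inj); rewrite s'AB.
- by rewrite -size_eq0 -(size_map val) map_drop s'AB drop_size_cat // size_eq0.
- apply: val_inj; rewrite !sum_val map_take s'AB take_size_cat // eqA.
  rewrite (perm_big _ (perm_eq_seq_mset _)).
  by rewrite (perm_big _ (perm_map val (perm_eq_seq_mset T))).
Qed.

(** The sum of the kept terms is invertible; cancelling it leaves sum 0 for the removed ones. *)
Lemma zero_subsum_of_reducible (T : seq U) :
  reducible (seq_mset T) ->
  exists B : seq S, [/\ subseq B (map val T), B != [::] & \sum_(b <- B) b = 0].
Proof.
case/reducible_perm=> A [B [TAB B0 eqA]].
have {}TAB : perm_eq T (A ++ B) by rewrite -(permPl (perm_eq_seq_mset T)).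
move: eqA; rewrite (perm_big _ (perm_eq_seq_mset T)) (perm_big _ TAB).
rewrite big_cat /= => eqA.
have [a' aa'] : exists a', val (\sum_(u <- A) u) + a' = 0.
  by apply/asboolP; apply: (valP (\sum_(u <- A) u)).
have sumB : \sum_(b <- map val B) b = 0 :> S.
  have := congr1 val eqA; rewrite raddfD -sum_val => /(congr1 (+%R^~ a')).
  by rewrite addrAC aa' add0r.
(* The removed terms form a sublist only after reordering. *)
have [|C sC BC] := (count_subseqP (map val B) (map val T)).1.
  move=> x; rewrite (permP (perm_map val TAB)) map_cat count_cat.
  exact: leq_addl.
exists C; split=> //.
  by rewrite -size_eq0 -(perm_size BC) size_map size_eq0.
by rewrite -(perm_big _ BC).
Qed.

Lemma exists_units_of_irreducible (T : {mset S}) : ~ reducible T ->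
  exists us : seq U, size us = size T /\ ~ reducible (seq_mset us).
Proof.
move=> irr.
have [A B lAB B0|us [size_us inv_us irr_us]] :=
  @units_of_seq R idem_power c c_inv c1_inv T 1.
  rewrite !mul1r -!sum_mul_semigroup; apply/eqP => E; apply: irr.
  by apply/reducible_perm; exists A, B.
have [s' s'us] := lift_units inv_us.
exists s'; split; first by rewrite -(size_map val) s'us size_us.
case/zero_subsum_of_reducible=> B [sB B0 sumB].
rewrite s'us in sB; have := irr_us B sB B0.
by rewrite mulr1 -sum_mul_semigroup sumB => /eqP.
Qed.

Lemma davenport_bound_units : @davenport_bound S =1 @davenport_bound U.
Proof.
move=> l; apply/asboolP/asboolP => bound T lT.
- rewrite -(seq_mset_id T); apply/reducible_units/bound.
  by rewrite (perm_size (perm_eq_seq_mset _)) size_map.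
- apply: contrapT => /exists_units_of_irreducible[us [size_us]]; apply.
  by apply: bound; rewrite (perm_size (perm_eq_seq_mset _)) size_us.
Qed.

End DavenportUnits.

(** * Idempotent powers in polynomial quotients *)

Lemma idempotent_power_of_repeat (R : pzRingType) (x : R) (i j : nat) :
  (i < j)%N -> x ^+ i = x ^+ j ->
  exists2 n, (0 < n)%N & x ^+ n * x ^+ n = x ^+ n.
Proof.
move=> ij eqx; set d := (j - i)%N.
have period k t : (i <= k)%N -> x ^+ (k + t * d) = x ^+ k.
  move=> ik; elim: t => [|t IHt]; first by rewrite addn0.
  rewrite mulSn addnCA addnC exprD IHt -exprD -(subnK ik) -addnA.
  by rewrite subnKC ?(ltnW ij) // !exprD -eqx.
have d_gt0 : (0 < d)%N by rewrite subn_gt0.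
(* A multiple of the period [d], at least [i] so that periodicity applies; [i.+1] keeps it positive
   when [i] is 0. *)
exists (i.+1 * d)%N; first by rewrite muln_gt0.
by rewrite -exprD period // (leq_trans (leqnSn i)) // leq_pmulr.
Qed.

Section PolyQuotient.

Local Open Scope quotient_scope.

Variables (F : finFieldType) (I : idealr {poly F}).

(** A class is determined by a remainder modulo [p], so the quotient is finite and the powers of [x]
    repeat. *)
Lemma ideal_quot_idem_power (p : {poly F}) : p \in I -> p != 0 ->
  forall x : {ideal_quot I},
    exists2 n, (0 < n)%N & x ^+ n * x ^+ n = x ^+ n.
Proof.
move=> pI p0 x; set d := size p.
pose red (y : {ideal_quot I}) : 'rV[F]_d := poly_rV (repr y %% p).
have red_inj : injective red.
  have size_red (q : {poly F}) : (size (q %% p)%R <= d)%N.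
    by rewrite ltnW // ltn_modp.
  move=> y z /(congr1 rVpoly).
  rewrite !(poly_rV_K (size_red _)) => eqyz.
  rewrite -[y]reprK -[z]reprK; apply/eqP; rewrite -Quotient.idealrBE.
  rewrite (divp_eq (repr y) p) (divp_eq (repr z) p) eqyz opprD addrACA subrr.
  by rewrite addr0 -mulrBl idealMr.
pose g (i : 'I_#|'rV[F]_d|.+1) := red (x ^+ i).
have /injectivePn[i [j ij /red_inj eqx]] : ~~ injectiveb g.
  by apply/negP => /injectiveP/leq_card; rewrite card_ord ltnn.
have [lt_ij|lt_ji|/val_inj/eqP] := ltngtP i j; last by rewrite (negPf ij).
  exact: idempotent_power_of_repeat lt_ij eqx.
exact: idempotent_power_of_repeat lt_ji (esym eqx).
Qed.

Lemma ideal_quot_invertible (a : F) :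
  a != 0 -> invertible (\pi_{ideal_quot I} a%:P).
Proof.
move=> a0; exists (\pi_{ideal_quot I} (a^-1)%:P).
by rewrite -rmorphM -polyCM mulfV // rmorph1.
Qed.

End PolyQuotient.

(* An [idealr] of {poly F} is proper by definition, so {ideal_quot I} <> 0; the
   quotient is {poly F} itself exactly when I = 0. *)
Theorem theorem1p1 (F : finFieldType) (I : idealr {poly F}) :
  (2 < #|F|)%N ->
  (exists2 p : {poly F}, p \in I & p != 0) ->
  davenport (mul_semigroup {ideal_quot I}) =
  davenport (unit_group (mul_semigroup {ideal_quot I})).
Proof.
move=> F_gt2 [p pI p0].
(* Here [q > 2] enters: both [a] and [a - 1] are nonzero scalars, hence invertible in the
   quotient. *)
have [a] : exists a : F, a \notin [:: 0; 1].
  apply/existsP; rewrite -negb_forall; apply: contraL F_gt2 => /forallP F01.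
  rewrite -leqNgt; apply: leq_trans (card_size [:: 0; 1 : F]).
  by apply/subset_leq_card/subsetP => a _; exact: F01.
rewrite !inE negb_or -[a == 1]subr_eq0 => /andP[a0 a1].
apply/eq_davenport/(davenport_bound_units _ (ideal_quot_invertible I a0)).
- exact: ideal_quot_idem_power pI p0.
- by have := ideal_quot_invertible I a1; rewrite polyCB rmorphB rmorph1.
Qed.
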